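(* Let $a,b,p,q\in\mathbb{Z}$ and let $(W_n)_{n\ge0}$ be defined by $W_0=a$, $W_1=b$, $W_n=pW_{n-1}+qW_{n-2}$ for $n\ge2$; let $(V_n)_{n\ge0}$ be defined by $V_0=2$, $V_1=p$, $V_n=pV_{n-1}+qV_{n-2}$ for $n\ge2$. Let $i$ be a positive integer and $n\ge2$ an integer. If $i$ is odd, then \[ W_{ni+i}=\sum_{j=0}^{\lfloor n/2\rfloor}\binom{n-j}{j}V_i^{\,n-2j}q^{ij}W_i+q^{i}a\sum_{j=0}^{\lfloor (n-1)/2\rfloor}\binom{n-j-1}{j}V_i^{\,n-2j-1}q^{ij}, \] and if $i$ is even, then \[ W_{ni+i}=\sum_{j=0}^{\lfloor n/2\rfloor}\binom{n-j}{j}(-1)^jV_i^{\,n-2j}q^{ij}W_i-q^{i}a\sum_{j=0}^{\lfloor (n-1)/2\rfloor}\binom{n-j-1}{j}(-1)^jV_i^{\,n-2j-1}q^{ij}. \]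
   Context: $W_n$ is the Horadam sequence $W_n(a,b;p,q)$ and $V_n$ the generalized Lucas sequence $W_n(2,p;p,q)$. *)

(* Defs.v *)
From mathcomp Require Import all_boot all_order all_algebra.
Set Implicit Arguments. Unset Strict Implicit. Unset Printing Implicit Defensive.
Import GRing.Theory.
Local Open Scope ring_scope.

Fixpoint horadam (a b p q : int) (n : nat) : int :=
  match n with
  | 0%N => a
  | 1%N => b
  | (m.+1 as k).+1 => p * horadam a b p q k + q * horadam a b p q m
  end.

Definition gen_lucas (p q : int) : nat -> int := horadam 2 p p q.

(* Main.v *)
(** Multiplication by [V_i] obeys [V_i W_(k+i) = W_(k+2i) + (-q)^i W_k], so the
    subsequence [W_0, W_i, W_(2i), ...] is itself a Horadam sequence, with
    parameters [V_i] and [- (-q)^i]. Any Horadam sequence is a combination of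
    the fundamental solution starting with [1, p], and the latter is a sum of
    binomial coefficients along a diagonal of Pascal's triangle. *)
Require Import Defs.
From mathcomp Require Import all_boot all_order all_algebra.
From mathcomp Require Import ring zify.
Import GRing.Theory.
Local Open Scope ring_scope.

Lemma horadamSS (a b p q : int) n :
  horadam a b p q n.+2 = p * horadam a b p q n.+1 + q * horadam a b p q n.
Proof. by []. Qed.

(** The roots of the characteristic polynomial have product [- q]. Two-step induction on [i], for
    all [k], avoids naming them. *)
Lemma gen_lucas_mul_horadam (a b p q : int) i k :
  gen_lucas p q i * horadam a b p q (k + i) =
    horadam a b p q (k + i.*2) + (- q) ^+ i * horadam a b p q k.
Proof.
elim/ltn_ind: i k => -[|[|i]] IH k.
- by rewrite /gen_lucas /= addn0 expr0; ring.
- by rewrite /gen_lucas /= addn1 addn2 horadamSS expr1; ring.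
(* The shifts of [k] make both instances involve the same [horadam a b p q (k + i.+2)], the factor
   to be multiplied. *)
have e1 := IH i.+1 (leqnn _) k.+1; have e0 := IH i (leqnSn _) k.+2.
rewrite (_ : k.+1 + i.+1 = k + i.+2)%N in e1; last by lia.
rewrite (_ : k.+1 + i.+1.*2 = (k + i.*2).+3)%N in e1; last by lia.
rewrite (_ : k.+2 + i = k + i.+2)%N in e0; last by lia.
rewrite (_ : k.+2 + i.*2 = (k + i.*2).+2)%N in e0; last by lia.
rewrite (_ : k + i.+2.*2 = (k + i.*2).+4)%N; last by lia.
rewrite [horadam a b p q (k + i.*2).+4]horadamSS.
rewrite [gen_lucas _ _ _]horadamSS -!/(gen_lucas p q _) mulrDl.
rewrite -[p * _ * _]mulrA -[q * _ * _]mulrA e1 e0 !exprSr.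
rewrite [horadam a b p q k.+2]horadamSS; ring.
Qed.

Lemma horadam_unique (p q : int) (X : nat -> int) :
  (forall n, X n.+2 = p * X n.+1 + q * X n) ->
  forall n, X n = horadam (X 0%N) (X 1%N) p q n.
Proof.
move=> XSS; elim/ltn_ind => -[|[|n]] IH //.
by rewrite horadamSS XSS (IH n.+1) // (IH n).
Qed.

(** As functions of [n], both sides solve the same recurrence, so agreement at [n = 0, 1]
    suffices. *)
Lemma horadam_fundamental (a b p q : int) n :
  horadam a b p q n.+2 =
    horadam 1 p p q n.+1 * b + q * a * horadam 1 p p q n.
Proof.
elim/ltn_ind: n => -[|[|n]] IH; [by rewrite /=; ring..|].
rewrite horadamSS (IH n.+1) // (IH n) // [horadam 1 p p q n.+3]horadamSS.
by rewrite [horadam 1 p p q n.+2]horadamSS; ring.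
Qed.

(** Pascal's rule matches the recurrence. Summing up to [n] adds only zero terms and spares a parity
    split in the induction. *)
Lemma horadam_binomial_sum (p q : int) n :
  horadam 1 p p q n =
    \sum_(0 <= j < n.+1) 'C(n - j, j)%:R * p ^+ (n - 2 * j) * q ^+ j.
Proof.
elim/ltn_ind: n => -[|[|n]] IH.
- by rewrite big_nat1 /= bin0; ring.
- by rewrite big_nat_recl // big_nat1 /= subn0 bin0 bin_small //; ring.
rewrite horadamSS (IH n.+1) // (IH n) //.
rewrite [in RHS]big_nat_recl // [in RHS]big_nat_recr //= [X in _ * X + _]big_nat_recl //.
rewrite (_ : 'C(n.+2 - n.+2, n.+2) = 0%N); last by rewrite subnn.
rewrite !mul0r addr0 mulrDr -addrA; congr (_ + _).
  by rewrite !muln0 !subn0 !bin0 [p ^+ n.+2]exprS; ring.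
rewrite !mulr_sumr -big_split /=; apply: eq_big_nat => j /andP[_ jn].
rewrite (_ : n.+2 - j.+1 = (n - j).+1)%N; last by lia.
rewrite [(n.+1 - j.+1)%N]subSS binS natrD.
rewrite (_ : n.+2 - 2 * j.+1 = n - 2 * j)%N; last by lia.
(* The truncated exponent [n.+1 - 2 * j.+1] is the predecessor of [n - 2 * j] only if [j < n - j];
   otherwise its binomial coefficient vanishes. *)
have [njl|njg] := ltnP (n - j) j.+1.
  by rewrite (bin_small njl) exprS; ring.
rewrite (_ : n - 2 * j = (n.+1 - 2 * j.+1).+1)%N; last by lia.
by rewrite !exprS; ring.
Qed.

Lemma horadam_binomial_sum_half (p q : int) n :
  horadam 1 p p q n =
    \sum_(0 <= j < (n %/ 2).+1) 'C(n - j, j)%:R * p ^+ (n - 2 * j) * q ^+ j.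
Proof.
rewrite horadam_binomial_sum (@big_cat_nat _ _ _ (n %/ 2).+1) //=; last by lia.
rewrite [X in _ + X]big_nat_cond [X in _ + X]big1 ?addr0 // => j.
by move=> /andP[/andP[nj _] _]; rewrite bin_small ?mul0r //; lia.
Qed.

Lemma horadam_mul_index (a b p q : int) i n :
  let s := - (- q) ^+ i in
  let v := gen_lucas p q i in
  horadam a b p q (n.+2 * i) =
    horadam 1 v v s n.+1 * horadam a b p q i + s * a * horadam 1 v v s n.
Proof.
move=> s v; pose X m := horadam a b p q (m * i).
have XSS m : X m.+2 = v * X m.+1 + s * X m.
  (* The multiplication identity is used at [k = m * i]. *)
  rewrite /X /s /v mulSnr [(m.+1 * i)%N]mulSnr gen_lucas_mul_horadam.
  by rewrite -addnA addnn; ring.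
by rewrite -/(X n.+2) (horadam_unique _ _ _ XSS) horadam_fundamental /X mul1n.
Qed.

Theorem theorem4 (a b p q : int) (i n : nat) (i_gt0 : (0 < i)%N) (n_ge2 : (2 <= n)%N) :
  let W := horadam a b p q in
  let V := gen_lucas p q in
  (odd i ->
     W (n * i + i)%N =
       \sum_(0 <= j < (n %/ 2).+1)
          'C(n - j, j)%:R * V i ^+ (n - 2 * j) * q ^+ (i * j) * W i
       + q ^+ i * a *
         \sum_(0 <= j < ((n - 1) %/ 2).+1)
            'C(n - j - 1, j)%:R * V i ^+ (n - 2 * j - 1) * q ^+ (i * j))
  /\
  (~~ odd i ->
     W (n * i + i)%N =
       \sum_(0 <= j < (n %/ 2).+1)
          'C(n - j, j)%:R * (-1) ^+ j * V i ^+ (n - 2 * j) * q ^+ (i * j) * W i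
       - q ^+ i * a *
         \sum_(0 <= j < ((n - 1) %/ 2).+1)
            'C(n - j - 1, j)%:R * (-1) ^+ j * V i ^+ (n - 2 * j - 1) * q ^+ (i * j)).
Proof.
case: n n_ge2 => // n _ W V; rewrite /W -mulSnr horadam_mul_index -/W -/V.
rewrite !horadam_binomial_sum_half subn1 /= mulr_suml.
split=> [i_odd | i_even].
  (* Parity of [i] enters only through the sign of the new parameter [- (- q) ^+ i]. *)
  have -> : - (- q) ^+ i = q ^+ i by rewrite exprNn -signr_odd i_odd; ring.
  congr (_ + _ * _); apply: eq_big_nat => j _; rewrite exprM //.
  by rewrite (_ : n.+1 - j - 1 = n - j)%N 1?(_ : n.+1 - 2 * j - 1 = n - 2 * j)%N //; lia.
(* Here the parameter is negative [q ^+ i]: its powers give [(-1) ^+ j], and its factor before [a]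
   gives the minus sign. *)
have -> : - (- q) ^+ i = - q ^+ i.
  by rewrite exprNn -signr_odd (negbTE i_even); ring.
rewrite !mulNr; congr (_ - _ * _); apply: eq_big_nat => j _.
  by rewrite [(- q ^+ i) ^+ j]exprNn exprM; ring.
rewrite (_ : n.+1 - j - 1 = n - j)%N; last by lia.
rewrite (_ : n.+1 - 2 * j - 1 = n - 2 * j)%N; last by lia.
by rewrite [(- q ^+ i) ^+ j]exprNn exprM; ring.
Qed.
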